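(* Let $k\ge1$ be an integer, let $\mathbf{e}\in\mathbb{R}^k$ be a unit vector, and let $\lambda\in(0,\infty)$. Let $\mathbf{X}$ be a random vector in $\mathbb{R}^k$ with a density $p$ with respect to Lebesgue measure such that $$M:=\mathsf{E}\,e^{\lambda\,\mathbf{e}\mathbf{X}}<\infty$$ and, for some $\mu\in[0,\lambda)$ and some $C\in(0,\infty)$, $$p(\mathbf{x})\le C\,e^{-\mu\,\mathbf{e}\mathbf{x}}\quad\text{for all }\mathbf{x}\in\mathbb{R}^k.$$ Let $\varepsilon:=\lambda-\mu$. Then for each natural $n$ there exists a finite constant $K_n$, which depends only on the numbers $n$, $\lambda$, $\mu$, $M$, and $C$, such that $$p^{*n}(\mathbf{x})\le K_n\,e^{-(\lambda-\varepsilon/n)\,\mathbf{e}\mathbf{x}}\quad\text{for all }\mathbf{x}\in\mathbb{R}^k.$$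
   Context: For $\mathbf{e},\mathbf{x}\in\mathbb{R}^k$, the juxtaposition $\mathbf{e}\mathbf{x}$ denotes the Euclidean scalar product. $p^{*n}$ denotes the $n$-fold convolution of $p$ with itself ($p^{*1}=p$), where convolution is defined pointwise by $(p*q)(\mathbf{x})=\int_{\mathbb{R}^k}p(\mathbf{x}-\mathbf{u})q(\mathbf{u})\,d\mathbf{u}$. *)

(* Defs.v *)
From HB Require Import structures.
From mathcomp Require Import all_boot all_order all_algebra.
From mathcomp Require Import all_classical all_reals all_analysis.
Set Implicit Arguments.
Unset Strict Implicit.
Unset Printing Implicit Defensive.
Import Order.TTheory GRing.Theory Num.Theory.
Import numFieldNormedType.Exports.
Local Open Scope classical_set_scope.
Local Open Scope ring_scope.

(* R^k is 'rV[R]_k. Its library norm `|x| is the sup norm, hence the separate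
   Euclidean scalar product and norm. *)
Definition dotrv (R : realType) (k : nat) (x y : 'rV[R]_k) : R :=
  \sum_(i < k) x 0 i * y 0 i.

Definition enorm (R : realType) (k : nat) (x : 'rV[R]_k) : R :=
  Num.sqrt (dotrv x x).

(* The library has no sigma-algebra on matrices. As for its n.-tuple T, we take
   the one generated by the coordinate functions, with the Borel sets on each
   factor R; this is the Borel sigma-algebra of R^k. *)
Definition measure_rV_display : measure_display.
Proof. exact: default_measure_display. Qed.

Section measurable_rV.
Context (R : realType) (k : nat).

Definition coord_rV (i : 'I_k) (x : 'rV[R]_k) : measurableTypeR R := x 0 i.

Let rV_set0 : g_sigma_preimage coord_rV set0.
Proof. exact: sigma_algebra0. Qed.

Let rV_setC A : g_sigma_preimage coord_rV A -> g_sigma_preimage coord_rV (~` A).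
Proof. exact: sigma_algebraC. Qed.

Let rV_bigcup (F : _^nat) : (forall i, g_sigma_preimage coord_rV (F i)) ->
  g_sigma_preimage coord_rV (\bigcup_i (F i)).
Proof. exact: sigma_algebra_bigcup. Qed.

HB.instance Definition _ := @isMeasurable.Build measure_rV_display
  'rV[R]_k (g_sigma_preimage coord_rV) rV_set0 rV_setC rV_bigcup.

Lemma measurable_coord_rV (i : 'I_k) : measurable_fun setT (coord_rV i).
Proof.
move=> _ Y mY; rewrite setTI; apply: sub_sigma_algebra => /=.
rewrite -bigcup_seq/=; exists i => /=; first by rewrite mem_index_enum.
by exists Y => //; rewrite setTI.
Qed.

Lemma measurable_fun_rVP d (T : measurableType d) (f : T -> 'rV[R]_k) :
  (forall i, measurable_fun setT (coord_rV i \o f)) -> measurable_fun setT f.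
Proof.
move=> mf _ A mA; rewrite setTI.
have sub : g_sigma_preimage (fun i => coord_rV i \o f) `<=` measurable.
  apply: smallest_sub; first exact: sigma_algebra_measurable.
  move=> B; rewrite -bigcup_seq /= => -[i _ [C mC <-]].
  exact: mf.
apply: sub; rewrite g_sigma_preimage_comp.
by exists A => //; rewrite setTI.
Qed.

End measurable_rV.

Definition cons_rV (R : realType) (k : nat)
  (z : measurableTypeR R * 'rV[R]_k) : 'rV[R]_k.+1 := row_mx (z.1)%:M z.2.

(* k-dimensional Lebesgue measure: the k-fold product of the Lebesgue measure on
   R, transported along (a, (x_1, ..., x_k)) |-> (a, x_1, ..., x_k). *)
Fixpoint lebesgue_rV (R : realType) (k : nat) : set 'rV[R]_k -> \bar R :=
  match k with
  | 0 => \d_(0 : 'rV[R]_0)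
  | k'.+1 => pushforward
      (product_measure1 (@lebesgue_measure R) (@lebesgue_rV R k'))
      (@cons_rV R k')
  end.

Section lebesgue_rV_measure.
Context (R : realType).
Local Open Scope ereal_scope.

Lemma cons_rV0 k (z : measurableTypeR R * 'rV[R]_k) : cons_rV z 0%R ord0 = z.1.
Proof.
transitivity (row_mx (z.1)%:M z.2 0%R (lshift k ord0)); last first.
  by rewrite row_mxEl mxE eqxx mulr1n.
by rewrite /cons_rV; congr (row_mx _ _ _ _); exact/val_inj.
Qed.

Lemma cons_rVS k (z : measurableTypeR R * 'rV[R]_k) (i : 'I_k) :
  cons_rV z 0%R (lift ord0 i) = z.2 0%R i.
Proof.
transitivity (row_mx (z.1)%:M z.2 0%R (rshift 1 i)); last first.
  by rewrite row_mxEr.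
by rewrite /cons_rV; congr (row_mx _ _ _ _); exact/val_inj.
Qed.

Lemma measurable_cons_rV k : measurable_fun setT (@cons_rV R k).
Proof.
apply: measurable_fun_rVP => i; case: (unliftP ord0 i) => [j|] ->.
  rewrite (_ : _ \o _ = @coord_rV R k j \o snd); last first.
    by apply/funext => z /=; rewrite /coord_rV cons_rVS.
  exact: measurableT_comp (measurable_coord_rV j) measurable_snd.
rewrite (_ : _ \o _ = fst); first exact: measurable_fst.
by apply/funext => z /=; rewrite /coord_rV cons_rV0.
Qed.

Lemma cons_rV_can k : cancel (fun x : 'rV[R]_k.+1 =>
  (x 0%R ord0 : measurableTypeR R, \row_i x 0%R (lift ord0 i))) (@cons_rV R k).
Proof.
move=> x; apply/rowP => i; case: (unliftP ord0 i) => [j|] ->.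
  by rewrite cons_rVS mxE.
by rewrite cons_rV0.
Qed.

Lemma measurable_uncons_rV k : measurable_fun setT (fun x : 'rV[R]_k.+1 =>
  (x 0%R ord0 : measurableTypeR R, \row_i x 0%R (lift ord0 i))).
Proof.
apply/measurable_fun_pairP; split; first exact: (measurable_coord_rV ord0).
apply: measurable_fun_rVP => i.
rewrite (_ : _ \o _ = @coord_rV R k.+1 (lift ord0 i)).
  exact: measurable_coord_rV.
by apply/funext => x /=; rewrite /coord_rV mxE.
Qed.

Let sigma_finite_prod (m1 : {sigma_finite_measure set (measurableTypeR R) -> \bar R})
    d (T : measurableType d) (m2 : {sigma_finite_measure set T -> \bar R}) :
  sigma_finite setT (m1 \x m2).
Proof.
have /sigma_finiteP[F [TF ndF Foo]] := sigma_finiteT m1.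
have /sigma_finiteP[G [TG ndG Goo]] := sigma_finiteT m2.
exists (fun n => F n `*` G n).
  rewrite -setXTT TF TG predeqE => -[x y]; split.
    move=> [/= [n _ Fnx] [k _ Gky]]; exists (maxn n k) => //; split.
    - by move: x Fnx; exact/subsetPset/ndF/leq_maxl.
    - by move: y Gky; exact/subsetPset/ndG/leq_maxr.
  by move=> [n _ []/= ? ?]; split; exists n.
move=> k; have [? ?] := Foo k; have [? ?] := Goo k.
split; first exact: measurableX.
by rewrite product_measure1E// lte_mul_pinfty// ge0_fin_numE.
Qed.

Let pushforward_sigma_finite d1 d2 (T1 : measurableType d1)
    (T2 : measurableType d2) (m : {measure set T1 -> \bar R})
    (f : T1 -> T2) (g : T2 -> T1) :
  sigma_finite setT m ->
  measurable_fun setT f -> measurable_fun setT g -> cancel f g ->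
  exists m' : {sigma_finite_measure set T2 -> \bar R},
    pushforward m f = m' :> (set T2 -> \bar R).
Proof.
move=> [F FT Foo] mf mg fg.
pose M : {measure set T2 -> \bar R} :=
  measure_function_pushforward__canonical__measure_function_Measure m mf.
have MT : sigma_finite setT M.
  exists (fun n => g @^-1` F n); first by rewrite -preimage_bigcup -FT.
  move=> n; have [mF Fn] := Foo n; split.
    by rewrite -[X in measurable X]setTI; exact: mg.
  rewrite /M /= /pushforward -comp_preimage (_ : g \o f = id) ?preimage_id//.
  by apply/funext => x /=; rewrite fg.
pose B := Measure_isSigmaFinite.Build _ _ _ M MT.
pose N : {sigma_finite_measure set T2 -> \bar R} := HB.pack (Measure.sort M) B.
by exists N.
Qed.

Let lebesgue_rV_is_measure k :
  exists m : {sigma_finite_measure set 'rV[R]_k -> \bar R},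
    @lebesgue_rV R k = m :> (set _ -> \bar R).
Proof.
elim: k => [|k [m mE]] /=; first by exists (\d_(0%R : 'rV[R]_0)).
rewrite mE; apply: pushforward_sigma_finite.
- exact: sigma_finite_prod.
- exact: measurable_cons_rV.
- exact: measurable_uncons_rV.
- move=> z; rewrite cons_rV0 [RHS]surjective_pairing; congr pair.
  by apply/rowP => i; rewrite mxE cons_rVS.
Qed.

Let lebesgue_rV0 k : @lebesgue_rV R k set0 = 0.
Proof. by have [m ->] := lebesgue_rV_is_measure k; rewrite measure0. Qed.

Let lebesgue_rV_ge0 k A : 0 <= @lebesgue_rV R k A.
Proof. by have [m ->] := lebesgue_rV_is_measure k; exact: measure_ge0. Qed.

Let lebesgue_rV_sigma_additive k : semi_sigma_additive (@lebesgue_rV R k).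
Proof.
by have [m ->] := lebesgue_rV_is_measure k; exact: measure_semi_sigma_additive.
Qed.

HB.instance Definition _ k := isMeasure.Build _ _ _ (@lebesgue_rV R k)
  (lebesgue_rV0 k) (@lebesgue_rV_ge0 k) (@lebesgue_rV_sigma_additive k).

Let lebesgue_rV_sigma_finite k : sigma_finite setT (@lebesgue_rV R k).
Proof. by have [m ->] := lebesgue_rV_is_measure k; exact: sigma_finiteT. Qed.

HB.instance Definition _ k := Measure_isSigmaFinite.Build _ _ _
  (@lebesgue_rV R k) (lebesgue_rV_sigma_finite k).

Lemma lebesgue_rVS k : @lebesgue_rV R k.+1 =
  pushforward (@lebesgue_measure R \x @lebesgue_rV R k) (@cons_rV R k).
Proof. by []. Qed.

Lemma lebesgue_rV_box k (a b : 'rV[R]_k) : (forall i, a 0%R i <= b 0%R i)%R ->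
  lebesgue_rV [set x : 'rV[R]_k | forall i, a 0%R i <= x 0%R i <= b 0%R i]%R =
  (\prod_(i < k) (b 0%R i - a 0%R i))%:E.
Proof.
elim: k a b => [|k IH] a b ab.
  by rewrite big_ord0 /= diracE mem_set//; case.
pose tl (c : 'rV[R]_k.+1) : 'rV[R]_k := \row_i c 0%R (lift ord0 i).
rewrite lebesgue_rVS /pushforward (_ : _ @^-1` _ =
  `[a 0%R ord0, b 0%R ord0]%classic `*`
  [set x : 'rV[R]_k | forall i, tl a 0%R i <= x 0%R i <= tl b 0%R i]%R); last first.
  apply/seteqP; split => z /=.
    move=> h; split; first by rewrite in_itv/= -cons_rV0.
    by move=> i; rewrite !mxE -cons_rVS.
  move=> [h0 h] i; case: (unliftP ord0 i) => [j|] ->.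
    by rewrite cons_rVS; have := h j; rewrite !mxE.
  by rewrite cons_rV0; move: h0; rewrite in_itv.
have mbox : measurable
    [set x : 'rV[R]_k | forall i, tl a 0%R i <= x 0%R i <= tl b 0%R i]%R.
  rewrite (_ : mkset _ = \bigcap_(i in [set: 'I_k])
      (@coord_rV R k i @^-1` `[tl a 0%R i, tl b 0%R i])); last first.
    apply/seteqP; split => x /= h i; first by move=> _; rewrite /= in_itv; exact: h.
    by have := h i I; rewrite /= in_itv.
  apply: fin_bigcap_measurable => // i _.
  by rewrite -[X in measurable X]setTI; exact: measurable_coord_rV.
rewrite product_measure1E//= [X in _ * X](IH (tl a) (tl b)); last first.
  by move=> i; rewrite !mxE.
rewrite lebesgue_measure_itv/= lte_fin big_ord_recl EFinM.
congr (_ * _); last by congr EFin; apply: eq_bigr => i _; rewrite !mxE.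
have := ab ord0; rewrite le_eqVlt => /predU1P[->|->//].
by rewrite ltxx subrr.
Qed.

End lebesgue_rV_measure.

Section density.
Context d (T : measurableType d) (R : realType) (P : probability T R) (k : nat).

Record is_density (X : {RV P >-> 'rV[R]_k}) (p : 'rV[R]_k -> R) : Prop := {
  density_measurable : measurable_fun setT p ;
  density_ge0 : forall x, 0 <= p x ;
  densityE : forall A : set 'rV[R]_k, measurable A ->
    distribution P X A = (\int[@lebesgue_rV R k]_(x in A) (p x)%:E)%E }.

End density.

Section convolution.
Context (R : realType) (k : nat).

(* Convolutions take values in \bar R, so that a divergent integral is +oo. *)
Definition convolution (p q : 'rV[R]_k -> \bar R) (x : 'rV[R]_k) : \bar R :=
  (\int[@lebesgue_rV R k]_u (p (x - u)%R * q u))%E.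

(* p^{*n}, meant for n >= 1: convpow p 1 = p, convpow p n.+1 = convpow p n * p;
   convpow p 0 = p is a junk value. *)
Definition convpow (p : 'rV[R]_k -> R) (n : nat) : 'rV[R]_k -> \bar R :=
  iter n.-1 (fun q => convolution q (EFin \o p)) (EFin \o p).

End convolution.

(* Main.v *)
Require Import Defs.
From HB Require Import structures.
From mathcomp Require Import all_boot all_order all_algebra.
From mathcomp Require Import all_classical all_reals all_analysis.
From mathcomp Require Import measurable_realfun ring lra.
Set Implicit Arguments.
Unset Strict Implicit.
Unset Printing Implicit Defensive.
Import Order.TTheory GRing.Theory Num.Theory.
Import numFieldNormedType.Exports.
Local Open Scope classical_set_scope.
Local Open Scope ring_scope.

(** Exponential tilting reduces the claim to one about a function q whose size
    is controlled in mass and in growth. Put [q y = e^(lambda e.y) p y]. Then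
    [q] has integral [M] and [q y <= C e^(eps e.y)], and since the scalar product
    is additive, tilting commutes with convolution (convolution_tilt), so the
    claim reads: [q^{*n}(x) <= K_n e^((eps/n) e.x)].

    The heuristic is that if [u_1 + ... + u_n = x], then some [u_i] satisfies
    [e.u_i <= e.x / n]; bounding that one factor pointwise by [C e^(eps e.x / n)]
    and integrating out the others, of total mass [M^(n-1)], gives
    [K_n = n C M^(n-1)]. As an induction on n: in
    [q^{*(n+1)}(x) = \int q^{*n}(x - u) q(u) du], either [e.u <= e.x/(n+1)], and
    the growth of [q] bounds [q(u)] by [C e^(eps e.x/(n+1))], or
    [e.(x-u) <= n e.x/(n+1)], and the induction hypothesis bounds [q^{*n}(x-u)]
    by [K_n e^(eps e.x/(n+1))]. The remaining factor is integrated, which gives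
    [K_(n+1) = C M^n + K_n M] (convolution_le_add, convpow_le).

    The mass of [q^{*n}] is [M^n] by Tonelli's theorem together with the
    invariance of Lebesgue measure under translations and reflections
    (integral_convolution, ge0_integral_rV_reflect). That the mass of [q] is [M]
    is the change of variables from the law of X to its density
    (ge0_integral_density). *)

(** * The scalar product and subtraction on row vectors *)

Lemma dotrvB (R : realType) (k : nat) (e x y : 'rV[R]_k) :
  dotrv e (x - y) = dotrv e x - dotrv e y.
Proof.
rewrite /dotrv -sumrB; apply: eq_bigr => i _.
by rewrite !mxE mulrBr.
Qed.

Lemma measurable_dotrv (R : realType) (k : nat) (e : 'rV[R]_k) :
  measurable_fun setT (dotrv e : 'rV[R]_k -> measurableTypeR R).
Proof.
rewrite /dotrv; apply: measurable_sum => i.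
by apply: measurable_funM => //; exact: measurable_coord_rV.
Qed.

Lemma measurable_subr_rV (R : realType) (k : nat) :
  measurable_fun setT (fun z : 'rV[R]_k * 'rV[R]_k => z.1 - z.2).
Proof.
apply: measurable_fun_rVP => i.
rewrite (_ : _ \o _ = fun z => coord_rV i z.1 - coord_rV i z.2); last first.
  by apply/funext => z /=; rewrite /coord_rV !mxE.
by apply: measurable_funB; apply: measurableT_comp (measurable_coord_rV i) _.
Qed.

Lemma measurable_subl_rV (R : realType) (k : nat) (x : 'rV[R]_k) :
  measurable_fun setT (fun u : 'rV[R]_k => x - u).
Proof.
exact: measurableT_comp (@measurable_subr_rV R k) (measurable_pair1 x).
Qed.

(** * Invariance of Lebesgue measure under x |-> a - x *)

Section reflection_invariance.
Context (R : realType).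
Local Open Scope ereal_scope.

(** A reflection maps ]b, c] to [a - c, a - b[, of the same length, and Lebesgue
    measure is determined by its values on half-open intervals. *)
Lemma lebesgue_measure_reflect (a : R) (A : set R) : measurable A ->
  pushforward (@lebesgue_measure R)
    ((fun t => a - t)%R : measurableTypeR R -> measurableTypeR R) A =
  lebesgue_measure A.
Proof.
move=> mA.
have mf : measurable_fun setT
    ((fun t => a - t)%R : measurableTypeR R -> measurableTypeR R).
  exact: measurable_funB.
pose nu : {measure set (measurableTypeR R) -> \bar R} :=
  measure_function_pushforward__canonical__measure_function_Measure
    (@lebesgue_measure R) mf.
apply/esym/(@lebesgue_measure_unique R nu) => // _ [[b c]] _ <-; rewrite /= /pushforward.
rewrite (_ : _ @^-1` _ = `[a - c, a - b[%classic)%R; last first.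
  by apply/seteqP; split => t /=; rewrite !in_itv/= => /andP[? ?];
    apply/andP; split; lra.
rewrite !lebesgue_measure_itv/= !lte_fin.
have -> : (a - c < a - b = (b < c))%R by apply/idP/idP; lra.
by case: ifP => // _; rewrite -!EFinB; congr EFin; ring.
Qed.

Lemma ge0_integral_reflect (a : R) (f : measurableTypeR R -> \bar R) :
  measurable_fun setT f -> (forall t, 0 <= f t) ->
  \int[@lebesgue_measure R]_t f (a - t)%R = \int[@lebesgue_measure R]_t f t.
Proof.
move=> mf f0.
have mr : measurable_fun setT
    ((fun t => a - t)%R : measurableTypeR R -> measurableTypeR R).
  exact: measurable_funB.
rewrite -[LHS](ge0_integral_pushforward mr _ measurableT mf)//.
by apply: eq_measure_integral => A mA _; exact: lebesgue_measure_reflect.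
Qed.

(** Unfolds one step of the recursive construction of the measure; this is the
    induction tool for integrals over row vectors. *)
Lemma ge0_integral_rVS (k : nat) (f : 'rV[R]_k.+1 -> \bar R) :
  measurable_fun setT f -> (forall x, 0 <= f x) ->
  \int[@lebesgue_rV R k.+1]_x f x =
  \int[@lebesgue_measure R]_a \int[@lebesgue_rV R k]_v f (@cons_rV R k (a, v)).
Proof.
move=> mf f0.
have mc := @measurable_cons_rV R k.
rewrite -(fubini_tonelli1 (f \o @cons_rV R k)); last 2 first.
- exact: measurableT_comp.
- by move=> z; exact: f0.
by rewrite -(ge0_integral_pushforward mc _ measurableT mf).
Qed.

Lemma cons_rVB (k : nat) (x : 'rV[R]_k.+1) (a : R) (v : 'rV[R]_k) :
  (x - @cons_rV R k (a, v) =
   @cons_rV R k (x 0 ord0 - a, \row_i x 0 (lift ord0 i) - v))%R.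
Proof.
have subE n (y z : 'rV[R]_n) j : ((y - z) 0 j = y 0 j - z 0 j)%R.
  by rewrite !mxE.
apply/rowP => i; rewrite subE; case: (unliftP ord0 i) => [j|] ->.
  by rewrite !cons_rVS /= subE mxE.
by rewrite !cons_rV0.
Qed.

(** Induction on the dimension: by Tonelli, the coordinates can be reflected one
    at a time. Reflections are treated first because [x - u] is the argument
    that occurs in a convolution; a translation is then a composition of two of
    them. *)
Lemma ge0_integral_rV_reflect (k : nat) (x : 'rV[R]_k) (f : 'rV[R]_k -> \bar R) :
  measurable_fun setT f -> (forall x, 0 <= f x) ->
  \int[@lebesgue_rV R k]_u f (x - u)%R = \int[@lebesgue_rV R k]_u f u.
Proof.
elim: k x f => [|k IH] x f mf f0.
  (* In dimension 0 all vectors are equal. *)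
  by apply: eq_integral => u _; congr f; apply/rowP; case.
have mfc := measurableT_comp mf (@measurable_cons_rV R k).
rewrite !ge0_integral_rVS//; last first.
  exact: measurableT_comp mf (@measurable_subl_rV _ _ x).
(* Reflect the first coordinate through G, then the others by induction for each
   fixed value of the first. *)
pose G (a : measurableTypeR R) := \int[@lebesgue_rV R k]_v f (@cons_rV R k (a, v)).
rewrite -[RHS](@ge0_integral_reflect (x 0%R ord0) G); last 2 first.
- by apply: (measurable_fun_fubini_tonelli_F (f \o @cons_rV R k)) => // z;
    exact: f0.
- by move=> a; exact: integral_ge0.
apply: eq_integral => a _.
under eq_integral do rewrite cons_rVB.
apply: (IH _ (fun v => f (@cons_rV R k ((x 0 ord0 - a)%R, v)))) => //.
exact: measurableT_comp mfc (measurable_pair1 _).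
Qed.

Lemma ge0_integral_rV_translate (k : nat) (u : 'rV[R]_k) (f : 'rV[R]_k -> \bar R) :
  measurable_fun setT f -> (forall x, 0 <= f x) ->
  \int[@lebesgue_rV R k]_x f (x - u)%R = \int[@lebesgue_rV R k]_x f x.
Proof.
move=> mf f0.
under eq_integral do rewrite -opprB -[(- _)%R]sub0r.
rewrite (@ge0_integral_rV_reflect _ u (fun y => f (0 - y)%R))//.
  exact: ge0_integral_rV_reflect.
exact: measurableT_comp mf (@measurable_subl_rV _ _ 0%R).
Qed.

End reflection_invariance.

(** * Convolution of nonnegative functions *)

Section convolution_theory.
Context (R : realType) (k : nat).
Local Open Scope ereal_scope.
Implicit Types f g : 'rV[R]_k -> \bar R.
Local Notation mu := (@lebesgue_rV R k).
Local Notation conv := (@convolution R k).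

Lemma measurable_convolution_integrand f g :
  measurable_fun setT f -> measurable_fun setT g ->
  measurable_fun setT (fun z : 'rV[R]_k * 'rV[R]_k => f (z.1 - z.2)%R * g z.2).
Proof.
move=> mf mg; apply: emeasurable_funM; last exact: measurableT_comp.
exact: measurableT_comp mf (@measurable_subr_rV R k).
Qed.

Lemma measurable_convolution f g :
  measurable_fun setT f -> measurable_fun setT g ->
  (forall x, 0 <= f x) -> (forall x, 0 <= g x) ->
  measurable_fun setT (conv f g).
Proof.
move=> mf mg f0 g0.
have mfg := measurable_convolution_integrand mf mg.
apply: (measurable_fun_fubini_tonelli_F (m2 := mu) _ mfg).
by move=> z; exact: mule_ge0.
Qed.

Lemma convolution_ge0 f g : (forall x, 0 <= f x) -> (forall x, 0 <= g x) ->
  forall x, 0 <= conv f g x.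
Proof. by move=> f0 g0 x; apply: integral_ge0 => u _; exact: mule_ge0. Qed.

(** After exchanging the integrals, the inner integral of [f (x - u)] over [x]
    does not depend on [u]. *)
Lemma integral_convolution f g :
  measurable_fun setT f -> measurable_fun setT g ->
  (forall x, 0 <= f x) -> (forall x, 0 <= g x) ->
  \int[mu]_x conv f g x = \int[mu]_x f x * \int[mu]_x g x.
Proof.
move=> mf mg f0 g0.
have mfg := measurable_convolution_integrand mf mg.
rewrite [LHS](fubini_tonelli (m1 := mu) (m2 := mu) _ mfg)/=; last first.
  by move=> z; exact: mule_ge0.
rewrite -ge0_integralZl//; last exact: integral_ge0.
apply: eq_integral => u _.
rewrite ge0_integralZr//; first by rewrite ge0_integral_rV_translate.
exact: measurableT_comp mf (measurableT_comp
  (@measurable_subr_rV R k) (measurable_pair2 u)).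
Qed.

(** If at every [u] one of the two factors is bounded, then
    [f (x - u) * g u <= a * f (x - u) + b * g u]. Stated as a pointwise
    disjunction, this avoids splitting the domain of integration. *)
Lemma convolution_le_add f g (a b : \bar R) x :
  measurable_fun setT f -> measurable_fun setT g ->
  (forall x, 0 <= f x) -> (forall x, 0 <= g x) -> 0 <= a -> 0 <= b ->
  (forall u, g u <= a \/ f (x - u)%R <= b) ->
  conv f g x <= a * \int[mu]_y f y + b * \int[mu]_y g y.
Proof.
move=> mf mg f0 g0 a0 b0 H.
have mfx := measurableT_comp mf (@measurable_subl_rV _ _ x).
rewrite -(@ge0_integral_rV_reflect _ _ x f)//.
rewrite -!ge0_integralZl// -ge0_integralD//; last 4 first.
- by move=> u _; exact: mule_ge0.
- exact: measurable_funeM.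
- by move=> u _; exact: mule_ge0.
- exact: measurable_funeM.
apply: ge0_le_integral => //.
- by move=> u _; exact: mule_ge0.
- exact: emeasurable_funM.
- by apply: emeasurable_funD; exact: measurable_funeM.
move=> u _; case: (H u) => h.
  rewrite (@le_trans _ _ (a * f (x - u)%R))//.
    by rewrite [leRHS]muleC lee_wpmul2l.
  by rewrite leeDl// mule_ge0.
rewrite (@le_trans _ _ (b * g u))//.
  by rewrite lee_wpmul2r.
by rewrite leeDr// mule_ge0.
Qed.

(** [e.(x - u) + e.u = e.x], so the two exponential weights multiply to a factor
    that leaves the integral. *)
Lemma convolution_tilt (lambda : R) (e : 'rV[R]_k) f g x :
  measurable_fun setT f -> measurable_fun setT g ->
  (forall x, 0 <= f x) -> (forall x, 0 <= g x) ->
  conv (fun y => (expR (lambda * dotrv e y))%:E * f y)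
       (fun y => (expR (lambda * dotrv e y))%:E * g y) x =
  (expR (lambda * dotrv e x))%:E * conv f g x.
Proof.
move=> mf mg f0 g0.
rewrite -ge0_integralZl//; last 2 first.
- apply: emeasurable_funM => //.
  exact: measurableT_comp mf (@measurable_subl_rV _ _ x).
- by move=> u _; exact: mule_ge0.
apply: eq_integral => u _.
rewrite muleACA -EFinM -expRD dotrvB; congr (_%:E * _).
by congr expR; ring.
Qed.

End convolution_theory.

(** * Random vectors with a density *)

(** The law of [X] has density [p], so its Radon-Nikodym derivative agrees with
    [p] almost everywhere, and integrals against the law become integrals against
    [p] by the change of variables for that derivative. *)
Lemma ge0_integral_density d (T : measurableType d) (R : realType)
    (P : probability T R) (k : nat) (X : {RV P >-> 'rV[R]_k})
    (p : 'rV[R]_k -> R) (g : 'rV[R]_k -> \bar R) :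
  is_density X p -> measurable_fun setT g -> (forall x, 0 <= g x)%E ->
  (\int[P]_w g (X w) = \int[@lebesgue_rV R k]_x (g x * (p x)%:E))%E.
Proof.
move=> [mp p0 pE] mg g0; rewrite -[LHS](ge0_integral_distribution X mg g0).
have mEp : measurable_fun setT (EFin \o p) by exact/measurable_EFinP.
have dom : distribution P X `<< @lebesgue_rV R k.
  apply/null_content_dominatesP => A mA A0; rewrite pE//.
  by apply: null_set_integral => //; exact: measurable_funTS.
have intf := Radon_Nikodym_SigmaFinite.f_integrable dom.
rewrite -(Radon_Nikodym_SigmaFinite.change_of_variables dom)//.
have mf := measurable_int _ intf.
apply: ae_eq_integral => //; [exact: emeasurable_funM..|].
apply: ae_eqe_mul2l; apply: integral_ae_eq => // A _ mA.
by rewrite -pE// -Radon_Nikodym_SigmaFinite.f_integral.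
Qed.

(** * Convolution powers *)

Section convolution_power.
Context (R : realType) (k : nat).
Implicit Types p : 'rV[R]_k -> R.
Local Notation mu := (@lebesgue_rV R k).

Lemma convpowS p n : convpow p n.+2 =
  convolution (convpow p n.+1) (EFin \o p).
Proof. by []. Qed.

Section ge0.
Variables (p : 'rV[R]_k -> R) (mp : measurable_fun setT p).
Hypothesis p0 : forall x, 0 <= p x.
Local Open Scope ereal_scope.

Let mEp : measurable_fun setT (EFin \o p).
Proof. exact/measurable_EFinP. Qed.

Let Ep0 x : 0 <= (EFin \o p) x.
Proof. by rewrite lee_fin. Qed.

Lemma convpow_ge0 n x : 0 <= convpow p n.+1 x.
Proof.
elim: n x => [|n IH] x; first exact: Ep0.
by rewrite convpowS; exact: convolution_ge0.
Qed.

Lemma measurable_convpow n : measurable_fun setT (convpow p n.+1).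
Proof.
elim: n => [|n IH]; first exact: mEp.
by rewrite convpowS; apply: measurable_convolution => //; exact: convpow_ge0.
Qed.

Lemma integral_convpow n :
  \int[mu]_x convpow p n.+1 x = (\int[mu]_x (p x)%:E) ^+ n.+1.
Proof.
elim: n => [|n IH]; first by rewrite expeS mule1.
rewrite convpowS integral_convolution//; last 2 first.
- exact: measurable_convpow.
- exact: convpow_ge0.
by rewrite IH [RHS]expeS muleC.
Qed.

Lemma convpow_tilt (lambda : R) (e : 'rV[R]_k) n x :
  convpow (fun y => expR (lambda * dotrv e y) * p y)%R n.+1 x =
  (expR (lambda * dotrv e x))%:E * convpow p n.+1 x.
Proof.
elim: n x => [|n IH] x; first by [].
rewrite !convpowS -convolution_tilt//; last 2 first.
- exact: measurable_convpow.
- exact: convpow_ge0.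
by congr (convolution _ _ _); apply/funext => y; exact: IH.
Qed.

(** The induction on [n] behind the theorem, for a function of mass [M] that
    grows at most like [C e^(eps e.x)]: the point [u] of the last factor either
    lies below its share [e.x / (n+2)] in direction [e], or leaves the first
    [n+1] factors below theirs. *)
Lemma convpow_le (e : 'rV[R]_k) (M C eps : R) : (0 <= eps)%R -> (0 <= C)%R ->
  \int[mu]_x (p x)%:E = M%:E ->
  (forall x, p x <= C * expR (eps * dotrv e x))%R ->
  forall n x, convpow p n.+1 x <=
    (n.+1%:R * C * M ^+ n * expR (eps / n.+1%:R * dotrv e x))%:E.
Proof.
move=> eps0 C0 pM pC.
have M0 : (0 <= M)%R by rewrite -lee_fin -pM; apply: integral_ge0 => x _; exact: Ep0.
elim=> [|n IH] x; first by rewrite lee_fin expr0 divr1 mul1r mulr1 pC.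
set b := expR (eps / n.+2%:R * dotrv e x).
have b0 : (0 <= b)%R by exact: expR_ge0.
have K0 : (0 <= n.+1%:R * C * M ^+ n)%R by rewrite !mulr_ge0 ?exprn_ge0.
(* The recursion K_(n+2) = C M^(n+1) + K_(n+1) M for K_n = n C M^(n-1). *)
have -> : (n.+2%:R * C * M ^+ n.+1 * b)%:E = (C * b)%:E * (M ^+ n.+1)%:E +
    (n.+1%:R * C * M ^+ n * b)%:E * M%:E.
  by rewrite -!EFinM -EFinD; congr EFin; rewrite exprS -natr1; ring.
rewrite EFin_expe -pM -integral_convpow convpowS.
apply: convolution_le_add; rewrite ?lee_fin ?mulr_ge0 ?exprn_ge0//.
- exact: measurable_convpow.
- exact: convpow_ge0.
move=> u; case: (leP (dotrv e u) (dotrv e x / n.+2%:R)%R) => h.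
  left; rewrite /= lee_fin (le_trans (pC u))// ler_wpM2l// ler_expR.
  by rewrite -mulrA [(_^-1 * _)%R]mulrC ler_wpM2l.
right; rewrite (le_trans (IH _))// lee_fin ler_wpM2l// ler_expR.
rewrite -!mulrA ler_wpM2l//.
rewrite dotrvB ler_pdivrMl ?ltr0n//.
have n2 : (n.+2%:R != 0 :> R)%R by rewrite pnatr_eq0.
have -> : (n.+1%:R * (n.+2%:R^-1 * dotrv e x) =
  dotrv e x - dotrv e x / n.+2%:R :> R)%R.
  by move: n2; rewrite -(@natr1 _ n.+1) => n2; field.
by rewrite lerB// ltW.
Qed.

End ge0.
End convolution_power.

(** * The pointwise bound *)

Theorem corollary2p3 (R : realType) :
  exists K : nat -> R -> R -> R -> R -> R,
  forall (k : nat) (k_ge1 : (1 <= k)%N)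
    (e : 'rV[R]_k) (e_unit : enorm e = 1)
    (lambda : R) (lambda_gt0 : 0 < lambda)
    (d : measure_display) (T : measurableType d) (P : probability T R)
    (X : {RV P >-> 'rV[R]_k}) (p : 'rV[R]_k -> R) (p_density : is_density X p)
    (M : R) (ME : 'E_P[fun w => expR (lambda * dotrv e (X w))]%E = M%:E)
    (mu : R) (mu_ge0 : 0 <= mu) (mu_lt : mu < lambda)
    (C : R) (C_gt0 : 0 < C)
    (p_le : forall x : 'rV[R]_k, p x <= C * expR (- (mu * dotrv e x))),
  let eps := lambda - mu in
  forall (n : nat) (n_ge1 : (1 <= n)%N) (x : 'rV[R]_k),
    (convpow p n x <=
      (K n lambda mu M C * expR (- ((lambda - eps / n%:R) * dotrv e x)))%:E)%E.
Proof.
exists (fun n _ _ M C => n%:R * C * M ^+ n.-1).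
move=> k _ e _ lambda _ d T P X p p_density M ME mu _ mu_lt C C_gt0 p_le eps.
case=> [//|n] _ x.
have [mp p0 _] := p_density.
pose tilt y := expR (lambda * dotrv e y).
have mtilt : measurable_fun setT (tilt : 'rV[R]_k -> measurableTypeR R).
  apply: measurableT_comp => //.
  by apply: measurable_funM => //; exact: measurable_dotrv.
pose q y := tilt y * p y.
have mq : measurable_fun setT q by exact: measurable_funM.
have q0 y : 0 <= q y by rewrite mulr_ge0// expR_ge0.
have intq : (\int[@lebesgue_rV R k]_y (q y)%:E)%E = M%:E.
  rewrite -ME unlock (ge0_integral_density (g := EFin \o tilt) p_density) /=.
  - by apply: eq_integral => y _; rewrite EFinM.
  - exact/measurable_EFinP.
  - by move=> y; rewrite lee_fin expR_ge0.
have qC y : q y <= C * expR (eps * dotrv e y).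
  rewrite (le_trans (ler_wpM2l (expR_ge0 _) (p_le y)))// mulrCA -expRD.
  by rewrite /eps mulrBl.
have eps0 : 0 <= eps by rewrite subr_ge0 ltW.
have := convpow_le mq q0 eps0 (ltW C_gt0) intq qC n x.
rewrite convpow_tilt// -lee_pdivlMl ?expR_gt0// => /le_trans; apply.
rewrite -EFinM lee_fin -expRN mulrCA -expRD le_eqVlt; apply/orP; left; apply/eqP.
by congr (_ * expR _); ring.
Qed.
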